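(* Let $q$ be an odd prime power, let $b\in\mathbb{F}_{q^6}$ with $b\neq0$, and let $U_b=\{(x,\,bx^q+x^{q^4}) : x\in\mathbb{F}_{q^6}\}$. Then $U_b$ is a maximum scattered $\mathbb{F}_q$-subspace of $\mathbb{F}_{q^6}\times\mathbb{F}_{q^6}$ if and only if $\Delta_b$ is a square in $\mathbb{F}_q^*$ (that is, $\Delta_b=u^2$ for some $u\in\mathbb{F}_q^*$).
   Context: An $\mathbb{F}_q$-subspace $U$ of $V=\mathbb{F}_{q^6}\times\mathbb{F}_{q^6}$ is called scattered if $\dim_{\mathbb{F}_q}(U\cap \langle \mathbf{u}\rangle_{\mathbb{F}_{q^6}})\le 1$ for every nonzero $\mathbf{u}\in V$; it is maximum scattered if moreover $\dim_{\mathbb{F}_q}U=6$. Put $N:=b^{q^3+1}\in\mathbb{F}_{q^3}$ and $$\Delta_b:=N^{2(q^2+q+1)}-2(N^{q^2+q+2}+N^{q^2+2q+1}+N^{2q^2+q+1})+N^2+N^{2q}+N^{2q^2}+8N^{q^2+q+1}-2(N^{q+1}+N^{q^2+q}+N^{q^2+1}),$$ which is an element of $\mathbb{F}_q$. *)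

(* Defs.v *)
From HB Require Import structures.
From mathcomp Require Import all_boot all_order all_fingroup all_algebra.
From mathcomp Require Import all_solvable all_field.

Set Implicit Arguments.
Unset Strict Implicit.
Unset Printing Implicit Defensive.

Import GRing.Theory.
Local Open Scope ring_scope.

Section FrobeniusLinear.
Variables (F : finFieldType) (L : fieldExtType F).

Lemma exprD_card (k : nat) (x y : L) :
  (x + y) ^+ (#|F| ^ k) = x ^+ (#|F| ^ k) + y ^+ (#|F| ^ k).
Proof.
have [p p_pr chF] := finPcharP F.
apply: exprDn_pchar; rewrite (eq_pnat _ (pchar_lalg L)).
have := pprimeChar_pgroup chF; rewrite /pgroup cardsT => pF.
by rewrite pnatX (eq_pnat _ (pcharf_eq chF)) pF.
Qed.

Lemma expf_card_exp (k : nat) (a : F) : a ^+ (#|F| ^ k) = a.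
Proof. by elim: k => [|k IHk]; rewrite ?expr1 // expnS exprM expf_card. Qed.

End FrobeniusLinear.

Section ScatteredSubspaces.
Variables (F : finFieldType) (L : fieldExtType F).

Definition lineL_fun (u : L * L) (c : L) : L * L := (c * u.1, c * u.2).

Lemma lineL_fun_linear (u : L * L) : linear (lineL_fun u).
Proof.
move=> a x y; rewrite /lineL_fun !mulrDl -!scalerAl.
by congr pair.
Qed.

HB.instance Definition _ (u : L * L) :=
  GRing.isLinear.Build F L (L * L)%type _ (lineL_fun u) (lineL_fun_linear u).

(* The L-span of u, as an F-subspace of L * L. *)
Definition lineL (u : L * L) : {vspace L * L} := limg (linfun (lineL_fun u)).

Lemma lineLP (u v : L * L) :
  reflect (exists c : L, v = (c * u.1, c * u.2)) (v \in lineL u).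
Proof.
apply: (iffP memv_imgP) => [[c _ ->] | [c ->]]; exists c; rewrite ?lfunE //.
by rewrite memvf.
Qed.

Definition scattered (U : {vspace L * L}) : Prop :=
  forall u : L * L, u != 0 -> (\dim (U :&: lineL u) <= 1)%N.

Definition maximum_scattered (U : {vspace L * L}) : Prop :=
  scattered U /\ \dim U = 6%N.

Definition Ub_fun (b x : L) : L * L := (x, b * x ^+ #|F| + x ^+ (#|F| ^ 4)).

Lemma Ub_fun_linear (b : L) : linear (Ub_fun b).
Proof.
move=> a x y; rewrite /Ub_fun; congr pair => /=.
have := exprD_card 1 (a *: x) y; rewrite !expn1 => ->.
have := expf_card_exp 1 a; rewrite expn1 => aq.
by rewrite exprD_card !exprZn aq expf_card_exp mulrDr -scalerAr addrACA scalerDr.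
Qed.

HB.instance Definition _ (b : L) :=
  GRing.isLinear.Build F L (L * L)%type _ (Ub_fun b) (Ub_fun_linear b).

Definition Ub (b : L) : {vspace L * L} := limg (linfun (Ub_fun b)).

Lemma UbP (b : L) (v : L * L) :
  reflect (exists x : L, v = (x, b * x ^+ #|F| + x ^+ (#|F| ^ 4)))
          (v \in Ub b).
Proof.
apply: (iffP memv_imgP) => [[x _ ->] | [x ->]]; exists x; rewrite ?lfunE //.
by rewrite memvf.
Qed.

Definition Delta (b : L) : L :=
  let q := #|F| in
  let N := b ^+ (q ^ 3 + 1) in
  N ^+ (2 * (q ^ 2 + q + 1))
  - 2%:R * (N ^+ (q ^ 2 + q + 2) + N ^+ (q ^ 2 + 2 * q + 1)
            + N ^+ (2 * q ^ 2 + q + 1))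
  + N ^+ 2 + N ^+ (2 * q) + N ^+ (2 * q ^ 2)
  + 8%:R * N ^+ (q ^ 2 + q + 1)
  - 2%:R * (N ^+ (q + 1) + N ^+ (q ^ 2 + q) + N ^+ (q ^ 2 + 1)).

End ScatteredSubspaces.

(* Main.v *)
Require Import Defs.
From HB Require Import structures.
From mathcomp Require Import all_boot all_order all_fingroup all_algebra.
From mathcomp Require Import all_solvable all_field.
From mathcomp Require Import zify ring.

(* Write x_i for x^(q^i). U_b fails to be scattered iff t*x and x give
   proportional vectors for some t outside F_q, i.e. b x_1 (t_1 - t_0) =
   x_4 (t_0 - t_4); by Hilbert 90 such an x exists iff N is the cross ratio
   (t_0 - t_4)(t_3 - t_1) / ((t_1 - t_0)(t_4 - t_3)).
   Fix w with w^q = -w and split t = r' + w s over F_{q^3}; with r = r'_1 - r'_0,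
   which ranges over the trace zero elements, and A = (N+1)/(N-1), this becomes
   r^2 = w^2 (s_0^2 + s_1^2 + 2 A s_0 s_1).  By the law of cosines the right-hand
   sides, for the conjugates, are w^2 times the squared sides of the triangle with
   vertices s_i e_i, where the e_i are unit vectors with Gram matrix given by
   -A_0, -A_1, -A_2, and r_0 + r_1 + r_2 = 0 says that this triangle is degenerate
   (Heron).  Its plane then has a radical, so every nonzero squared side is -D times
   a square, D being the Gram determinant, and 4 Delta = -D (Norm(N-1))^2.  As w^2
   is not a square in F_{q^3}, this forbids solutions when Delta is a nonzero
   square.  Conversely, degeneracy is a ternary quadratic equation over F_q in
   1/s, which is isotropic; when D = 0 it cuts out a plane on which the squared
   side is an F_q-valued binary form up to a constant, hence takes values in
   either square class. *)

Set Implicit Arguments.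
Unset Strict Implicit.
Unset Printing Implicit Defensive.

Import GRing.Theory.
Local Open Scope ring_scope.

(** * Powers of Frobenius, a generator of the multiplicative group, and square roots *)

Section Frobenius.
Variables (F : finFieldType) (L : fieldExtType F).
Implicit Types x y z : L.

Definition frob (k : nat) (x : L) : L := x ^+ (#|F| ^ k).

Fact frob_linear k : linear (frob k).
Proof. by move=> a x y; rewrite /frob exprD_card exprZn expf_card_exp. Qed.

Fact frob_monoid_morphism k : monoid_morphism (frob k).
Proof. by split=> [|x y]; rewrite /frob ?expr1n ?exprMn. Qed.

HB.instance Definition _ k :=
  GRing.isLinear.Build F L L _ (frob k) (frob_linear k).
HB.instance Definition _ k :=
  GRing.isMonoidMorphism.Build L L (frob k) (frob_monoid_morphism k).

Lemma frob_comp j k x : frob j (frob k x) = frob (k + j) x.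
Proof. by rewrite /frob -exprM expnD. Qed.

Lemma mem_base_field x : (x \in 1%VS) = (frob 1 x == x).
Proof. by have := Fermat's_little_theorem 1%AS x; rewrite dimv1. Qed.

Hypothesis q_odd : odd #|F|.

Lemma two_neq0 : 2 != 0 :> L.
Proof.
apply/negP=> two0; have chF : 2%N \in [pchar F].
  by rewrite -(pchar_lalg L) inE /=.
have := pprimeChar_pgroup chF; rewrite /pgroup cardsT => F2.
have q1 : #|F| = 1%N by apply: (pnat_1 F2); rewrite -odd_2'nat.
by have := finNzRing_gt1 F; rewrite q1.
Qed.

Hypothesis dimL : \dim {:L} = 6%N.

Lemma frob6 x : frob 6 x = x.
Proof.
have := Fermat's_little_theorem {:L}%AS x.
by rewrite memvf dimL => /esym/eqP.
Qed.

Lemma frob7 x : frob 7 x = frob 1 x.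
Proof. by rewrite -(frob_comp 1 6) frob6. Qed.

(** The nonzero elements, counted on [finvect_type], are q^6 - 1 distinct roots of unity of that
    exponent, and so many of them in a field force a primitive one. *)
Lemma exists_generator : exists g : L, (#|F| ^ 6).-1.-primitive_root g.
Proof.
pose T := finvect_type L.
have cardT : #|T| = (#|F| ^ 6)%N.
  rewrite -dimL -(card_vspace (T := T)).
  by apply: eq_card => v; rewrite memvf.
have q_gt1 := finNzRing_gt1 F.
have n_gt0 : (0 < (#|F| ^ 6).-1)%N.
  by rewrite -ltnS prednK ?expn_gt0 ?(ltnW q_gt1) // (ltn_exp2l 0).
pose s := [seq x <- enum T | x != 0].
have /hasP[g _ gP] : has (#|F| ^ 6).-1.-primitive_root (s : seq L).
  apply: has_prim_root => //.
  - apply/allP=> x; rewrite mem_filter => /andP[x_neq0 _].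
    apply/unity_rootP/(mulfI x_neq0).
    rewrite -exprS prednK ?expn_gt0 ?(ltnW q_gt1) // mulr1; exact: frob6.
  - exact/filter_uniq/enum_uniq.
  - rewrite -cardT cardE -(count_predC (pred1 (0 : T)) (enum T)).
    rewrite (count_uniq_mem _ (enum_uniq T)) mem_enum inE.
    by rewrite size_filter.
by exists g.
Qed.

(** Since q is odd, 2(q - 1) divides q^6 - 1. An element w of order 2(q - 1) satisfies w^(q-1) =
    -1. *)
Lemma exists_antifixed : exists2 w : L, w != 0 & frob 1 w = - w.
Proof.
have [g gP] := exists_generator; have q_gt1 := finNzRing_gt1 F.
have dvd_n : (2 * #|F|.-1 %| (#|F| ^ 6).-1)%N.
  apply/dvdnP; exists (#|F|.+1./2 * (1 + #|F| ^ 2 + #|F| ^ 4))%N.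
  have [m Em] : exists m, #|F| = m.*2.+1.
    by exists #|F|./2; rewrite -[LHS]odd_double_half q_odd.
  have -> : (#|F| ^ 6 = (#|F|.+1./2 * (1 + #|F| ^ 2 + #|F| ^ 4) *
                         (2 * #|F|.-1)).+1)%N.
    by rewrite Em -doubleS doubleK /= -addn1 -[RHS]addn1 -!muln2; ring.
  by [].
have := dvdn_prim_root gP dvd_n; set w := g ^+ _ => wP.
have w_neq0 : w != 0 by rewrite (prim_root_eq0 wP) muln_eq0 /= -lt0n -subn1 subn_gt0.
exists w => //; have : (w ^+ #|F|.-1) ^+ 2 == 1.
  by rewrite -exprM -(prim_order_dvd wP) mulnC.
rewrite sqrf_eq1 -(prim_order_dvd wP) => /orP[/dvdn_leq|/eqP w1].
  rewrite -subn1 subn_gt0 q_gt1 -[X in (_ <= X)%N]mul1n.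
  by rewrite leq_pmul2r ?subn_gt0 // => /(_ isT).
rewrite /frob expn1 -(prednK (ltnW q_gt1)) exprS w1; ring.
Qed.

(** In terms of a generator g of the nonzero elements, those fixed by [frob 3] are the powers of g
    whose exponent is a multiple of q^3 + 1, which is even. *)
Lemma sqrt_frob3_fixed x : frob 3 x = x -> exists y, x = y ^+ 2.
Proof.
move=> x_fix; have [->|x_neq0] := eqVneq x 0.
  by exists 0; rewrite expr0n.
have [g gP] := exists_generator; have q_gt1 := finNzRing_gt1 F.
have xn : x ^+ (#|F| ^ 6).-1 = 1.
  apply/(mulfI x_neq0); rewrite -exprS prednK ?expn_gt0 ?(ltnW q_gt1) // mulr1.
  exact: frob6.
have [[k _] /= xE] := prim_rootP gP xn.
have : x ^+ (#|F| ^ 3).-1 == 1.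
  apply/eqP/(mulfI x_neq0); rewrite -exprS prednK ?expn_gt0 ?(ltnW q_gt1) // mulr1.
  exact: x_fix.
have n_fact : (#|F| ^ 6).-1 = ((#|F| ^ 3).+1 * (#|F| ^ 3).-1)%N.
  by rewrite -[6%N]/(3 + 3)%N expnD; nia.
rewrite xE -exprM -(prim_order_dvd gP) n_fact dvdn_pmul2r; last first.
  by rewrite -subn1 subn_gt0 (ltn_exp2l 0).
move=> k_dvd; exists (g ^+ k./2); rewrite -exprM muln2.
have /negbTE k_even : ~~ odd k.
  by rewrite -dvdn2 (dvdn_trans _ k_dvd) // dvdn2 /= negbK oddX q_odd.
by rewrite -[in LHS](odd_double_half k) k_even.
Qed.

End Frobenius.

(** * Values and zeros of quadratic forms over a finite field of odd order *)

Section QuadraticForms.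
Variables (F : finFieldType) (q_odd : odd #|F|).

(** Choose a root [r s] of each square s. Recording x^2 and whether x is the chosen root is
    injective, so the squares make up at least half of F; as #|F| is odd, they make up more. *)
Lemma card_squares : (#|F| < 2 * #|[set x ^+ 2 | x : F]|)%N.
Proof.
set S := [set _ | _ in _].
have: (#|F| <= 2 * #|S|)%N.
  pose r (s : F) := odflt 0 [pick x | x ^+ 2 == s].
  have rK x : r (x ^+ 2) ^+ 2 = x ^+ 2.
    by rewrite /r; case: pickP => [y /eqP|/(_ x)] //=; rewrite eqxx.
  pose f x := (x ^+ 2, x == r (x ^+ 2)).
  have f_inj : injective f.
    move=> x y [xy2]; rewrite -xy2.
    have : x ^+ 2 == r (x ^+ 2) ^+ 2 by rewrite rK.
    have : y ^+ 2 == r (x ^+ 2) ^+ 2 by rewrite -xy2 rK.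
    rewrite !eqf_sqr => ys /orP[/eqP <-|/eqP xs].
      by rewrite eqxx => /esym/eqP.
    case/orP: ys => /eqP ys; first by rewrite -ys eqxx => /eqP.
    by rewrite xs ys.
  rewrite -[in leqLHS](card_codom f_inj) mulnC -card_bool -cardsT -cardsX.
  apply/subset_leq_card/subsetP=> _ /codomP[x ->].
  by rewrite in_setX in_setT andbT; apply: imset_f.
rewrite leq_eqVlt => /orP[/eqP Eq|//].
by move: q_odd; rewrite Eq mul2n odd_double.
Qed.

(** Pigeonhole: the values a x^2 and the values e - c y^2 each fill more than half of F. *)
Lemma sum_weighted_squares (a c e : F) :
  a != 0 -> c != 0 -> exists x y, a * x ^+ 2 + c * y ^+ 2 = e.
Proof.
move=> a_neq0 c_neq0; set S := [set x ^+ 2 | x : F].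
pose A := [set a * s | s in S]; pose C := [set e - c * s | s in S].
have cardA : #|A| = #|S| by apply/card_imset/mulfI.
have cardC : #|C| = #|S|.
  by apply: card_imset => x y /addrI/oppr_inj/(mulfI c_neq0).
have [AC0|[z /setIP[]]] := set_0Vmem (A :&: C).
  have := cardsUI A C; rewrite AC0 cards0 addn0 cardA cardC.
  rewrite addnn -mul2n => cardU; have := max_card (A :|: C).
  by rewrite cardU leqNgt card_squares.
case/imsetP=> _ /imsetP[x _ ->] zx /imsetP[_ /imsetP[y _ ->] zy].
by exists x, y; rewrite -zx zy subrK.
Qed.

Variable L : vectType F.

Lemma dim_cap_lker_line (U : vectType F) (f : 'Hom(L, U)) (V : {vspace L}) (a : U) :
  (forall v, v \in V -> f v \in <[a]>%VS) ->
  (\dim V <= (\dim (V :&: lker f)).+1)%N.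
Proof.
move=> fV; rewrite -(limg_ker_dim f V) -addn1 leq_add2l.
apply: leq_trans (_ : \dim <[a]> <= 1)%N; last by rewrite dim_vline leq_b1.
by apply/dimvS/subvP=> _ /memv_imgP[v vV ->]; apply: fV.
Qed.

Lemma dim_gt0_neq0 (V : {vspace L}) :
  (0 < \dim V)%N -> exists2 v, v \in V & v != 0.
Proof.
move=> dimV; exists (vpick V); first exact: memv_pick.
by rewrite vpick0 -dimv_eq0 -lt0n.
Qed.

Variables (V : {vspace L}) (B : L -> L -> F).
Hypotheses (B_lin : forall u, linear (B u : L -> F^o)).
Hypothesis (B_sym : forall u v, u \in V -> v \in V -> B u v = B v u).

Let BD u v w : B u (v + w) = B u v + B u w.
Proof. by have := B_lin u 1 v w; rewrite !scale1r. Qed.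

Let B0 u : B u 0 = 0.
Proof. by have := B_lin u (-1) 0 0; rewrite scaler0 addr0 scaleN1r addNr. Qed.

Let BZ u a v : B u (a *: v) = a * B u v.
Proof. by have := B_lin u a v 0; rewrite addr0 B0 addr0. Qed.

Lemma orthogonal_dim u : exists W : {vspace L}, [/\ (W <= V)%VS,
  (\dim V <= (\dim W).+1)%N & forall w, w \in W -> B u w = 0].
Proof.
pose lin := GRing.isLinear.Build F L F^o _ _ (B_lin u).
pose f : {linear L -> F^o} := HB.pack (B u : L -> F^o) lin.
exists (V :&: lker (linfun f))%VS; split; first exact: capvSl.
  apply: (@dim_cap_lker_line F^o _ _ 1) => v _.
  by apply/vlineP; exists (linfun f v); rewrite [RHS]mulr1.
by move=> w /memv_capP[_]; rewrite memv_ker lfunE => /eqP.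
Qed.

(** Two orthogonal anisotropic vectors give a diagonal binary form, which takes every value by
    [sum_weighted_squares]. *)
Lemma quadratic_zero_or_value (k : F) : (1 < \dim V)%N -> k != 0 ->
  exists v, [/\ v \in V, v != 0 & B v v = 0 \/ B v v = k].
Proof.
move=> dimV k_neq0; have [u uV u_neq0] := dim_gt0_neq0 (ltnW dimV).
have [Bu0|Bu] := eqVneq (B u u) 0; first by exists u; split; [| |left].
have [W [WV dimW W0]] := orthogonal_dim u.
have [v vW v_neq0] := dim_gt0_neq0 (leq_trans dimV dimW : 0 < \dim W)%N.
have vV := subvP WV v vW.
have [Bv0|Bv] := eqVneq (B v v) 0; first by exists v; split; [| |left].
have [x [y xy]] := sum_weighted_squares k Bu Bv.
have zV : x *: u + y *: v \in V by rewrite memvD ?memvZ.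
have Bz : B (x *: u + y *: v) (x *: u + y *: v) = k.
  have Bzw w : w \in V -> B (x *: u + y *: v) w = x * B u w + y * B v w.
    by move=> wV; rewrite B_sym // BD !BZ !(B_sym wV).
  by rewrite BD !BZ !Bzw // (B_sym vV uV) (W0 v) // -xy; ring.
exists (x *: u + y *: v); split=> //; last by right.
by apply: contra_neq k_neq0 => z0; rewrite -Bz z0 B0.
Qed.

End QuadraticForms.

(** If w is anisotropic, its orthogonal space has dimension at least 2, so it contains either a zero
    of the form or some v of value - B w w; in the latter case v + w is isotropic. *)
Lemma quadratic_isotropic (F : finFieldType) (L : vectType F)
    (V : {vspace L}) (B : L -> L -> F) : odd #|F| ->
  (forall u, linear (B u : L -> F^o)) ->
  (forall u v, u \in V -> v \in V -> B u v = B v u) -> (2 < \dim V)%N ->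
  exists v, [/\ v \in V, v != 0 & B v v = 0].
Proof.
move=> q_odd B_lin B_sym dimV.
have B0 u : B u 0 = 0.
  by have := B_lin u (-1) 0 0; rewrite scaler0 addr0 scaleN1r addNr.
have [w wV w_neq0] := dim_gt0_neq0 (ltnW (ltnW dimV)).
have [Bw0|Bw] := eqVneq (B w w) 0; first by exists w.
have [W [WV dimW W0]] := orthogonal_dim V B_lin w.
have B_symW u v : u \in W -> v \in W -> B u v = B v u.
  by move=> uW vW; apply: B_sym; apply: (subvP WV).
have := quadratic_zero_or_value q_odd B_lin B_symW (leq_trans dimV dimW : 1 < \dim W)%N.
move=> /(_ (- B w w)); rewrite oppr_eq0 => /(_ Bw).
case=> v [vW v_neq0 [Bv0|BvE]]; have vV := subvP WV v vW; first by exists v.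
have BD u x y : B u (x + y) = B u x + B u y.
  by have := B_lin u 1 x y; rewrite !scale1r.
exists (v + w); split; first by rewrite memvD.
  apply: contraNneq Bw => vw0; rewrite -oppr_eq0 -BvE; move/eqP: vw0.
  rewrite addr_eq0 => /eqP vE; rewrite {2}vE.
  by have := B_lin v (-1) w 0; rewrite addr0 B0 addr0 !scaleN1r => ->;
    rewrite -B_sym // (W0 v) // oppr0.
have Bvw x : x \in V -> B (v + w) x = B v x + B w x.
  by move=> xV; rewrite B_sym ?memvD // BD !(B_sym x).
by rewrite BD !Bvw // (B_sym v w) // (W0 v) // BvE; ring.
Qed.

(** * Polynomial identities for a triangle with vertices on three given lines *)

Section Collinearity.
Variable K : fieldType.
Implicit Types A B C D N d p r x y z : K.

(** Squared distance between x e_0 and y e_1. Throughout, the unit vectors e_i have inner products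
    -A for e_0 and e_1, -B for e_1 and e_2, -C for e_2 and e_0. *)
Definition edge A x y := x ^+ 2 + y ^+ 2 + 2 * A * x * y.

Definition gram_det A B C := 1 - A ^+ 2 - B ^+ 2 - C ^+ 2 - 2 * A * B * C.

(* Bilinear form of the adjugate of the Gram matrix of the e_i. *)
Definition adj_form A B C x y z (x' y' z' : K) :=
  (1 - B ^+ 2) * x * x' + (1 - C ^+ 2) * y * y' + (1 - A ^+ 2) * z * z'
  + (A + B * C) * (x * y' + y * x') + (C + A * B) * (x * z' + z * x')
  + (B + A * C) * (y * z' + z * y').

Lemma adj_form_linear A B C x y z k (u v w u' v' w' : K) :
  adj_form A B C x y z (k * u + u') (k * v + v') (k * w + w') =
  k * adj_form A B C x y z u v w + adj_form A B C x y z u' v' w'.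
Proof. rewrite /adj_form; ring. Qed.

Lemma adj_form_sym A B C x y z (u v w : K) :
  adj_form A B C x y z u v w = adj_form A B C u v w x y z.
Proof. rewrite /adj_form; ring. Qed.

Lemma adj_form_rot A B C x y z (x' y' z' : K) :
  adj_form B C A y z x y' z' x' = adj_form A B C x y z x' y' z'.
Proof. rewrite /adj_form; ring. Qed.

(* Inner product of the two triangle sides at the vertex x e_0. *)
Definition corner A B C x y z := x ^+ 2 + A * x * y + C * x * z - B * y * z.

Lemma rmorph_edge (f : {rmorphism K -> K}) A x y :
  f (edge A x y) = edge (f A) (f x) (f y).
Proof. by rewrite /edge !rmorphD !rmorphXn !rmorphM rmorph_nat. Qed.

Lemma rmorph_adj_form (f : {rmorphism K -> K}) A B C x y z (x' y' z' : K) :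
  f (adj_form A B C x y z x' y' z') =
  adj_form (f A) (f B) (f C) (f x) (f y) (f z) (f x') (f y') (f z').
Proof.
by rewrite /adj_form !(rmorphD, rmorphN, rmorphM, rmorphXn, rmorph1).
Qed.

Lemma rmorph_corner (f : {rmorphism K -> K}) A B C x y z :
  f (corner A B C x y z) = corner (f A) (f B) (f C) (f x) (f y) (f z).
Proof. by rewrite /corner rmorphB !rmorphD rmorphXn !rmorphM. Qed.

(** The Desnanot-Jacobi identity for the Gram matrix of e_0 and the two sides at x e_0. Its
    determinant is [gram_det A B C * (y * z) ^+ 2], and x + A y, x + C z are the inner products of
    e_0 with these sides. *)
Lemma corner_sqr A B C x y z :
  (corner A B C x y z * (x + A * y) - edge A x y * (x + C * z)) ^+ 2 =
  - gram_det A B C * edge A x y * (y * z) ^+ 2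
  + (edge A x y - (x + A * y) ^+ 2)
    * (edge A x y * edge C z x - corner A B C x y z ^+ 2).
Proof. rewrite /corner /edge /gram_det; ring. Qed.

(** The law of cosines. *)
Lemma cornerE A B C x y z :
  2 * corner A B C x y z = edge A x y + edge C z x - edge B y z.
Proof. rewrite /corner /edge; ring. Qed.

(** The wedge of the two sides is xyz times the combination of the e_j ^ e_k with coefficients 1/x,
    1/y, 1/z, and the Gram matrix of these bivectors is the adjugate. *)
Lemma edges_adj_form A B C x y z : x != 0 -> y != 0 -> z != 0 ->
  edge A x y * edge C z x - corner A B C x y z ^+ 2 =
  (x * y * z) ^+ 2 * adj_form A B C x^-1 y^-1 z^-1 x^-1 y^-1 z^-1.
Proof.
move=> x0 y0 z0; rewrite /edge /corner /adj_form; field.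
by rewrite x0 y0 z0.
Qed.

(** Three sides of length zero span a totally isotropic plane, impossible for a nondegenerate
    ternary form. The computation substitutes the resulting values of A, B, C into the
    determinant. *)
Lemma edges_eq0 A B C x y z : 2 != 0 :> K -> x != 0 -> y != 0 -> z != 0 ->
  edge A x y = 0 -> edge B y z = 0 -> edge C z x = 0 -> gram_det A B C = 0.
Proof.
move=> two0 x0 y0 z0 eA eB eC.
have {}eA : 2 * A * x * y = - (x ^+ 2 + y ^+ 2).
  by apply/eqP; rewrite -addr_eq0 addrC; apply/eqP.
have {}eB : 2 * B * y * z = - (y ^+ 2 + z ^+ 2).
  by apply/eqP; rewrite -addr_eq0 addrC; apply/eqP.
have {}eC : 2 * C * z * x = - (z ^+ 2 + x ^+ 2).
  by apply/eqP; rewrite -addr_eq0 addrC; apply/eqP.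
have c0 : (2 * x * y * z) ^+ 2 != 0 by rewrite expf_neq0 ?mulf_neq0.
apply/(mulfI c0); rewrite mulr0.
have -> : (2 * x * y * z) ^+ 2 * gram_det A B C =
    (2 * x * y * z) ^+ 2 - (z * (2 * A * x * y)) ^+ 2
    - (x * (2 * B * y * z)) ^+ 2 - (y * (2 * C * z * x)) ^+ 2
    - (2 * A * x * y) * (2 * B * y * z) * (2 * C * z * x).
  by rewrite /gram_det; ring.
by rewrite eA eB eC; ring.
Qed.

(** A vanishing sum of the p_i makes the Gram determinant of two sides vanish, up to d^2, so only
    the term with [gram_det] survives in [corner_sqr]. *)
Lemma collinear_sides d A B C x y z p0 p1 p2 : 2 != 0 :> K ->
    p0 + p1 + p2 = 0 -> p0 ^+ 2 = d * edge A x y ->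
    p1 ^+ 2 = d * edge B y z -> p2 ^+ 2 = d * edge C z x -> p0 != 0 ->
  (p2 * (x + A * y) + p0 * (x + C * z)) ^+ 2 = - gram_det A B C * d * (y * z) ^+ 2.
Proof.
move=> two0 p_sum e0 e1 e2 p0_neq0.
have p02 : p0 * p2 = - (d * corner A B C x y z).
  apply/(mulfI two0); transitivity (- (d * (2 * corner A B C x y z))).
    have p1E : p1 = - (p0 + p2) by rewrite -[LHS]subr0 -p_sum; ring.
    by rewrite cornerE mulrBr mulrDr -e0 -e1 -e2 p1E; ring.
  by ring.
apply/(mulfI (expf_neq0 2 p0_neq0)).
have -> : p0 ^+ 2 * (p2 * (x + A * y) + p0 * (x + C * z)) ^+ 2 =
    (p0 * p2 * (x + A * y) + p0 ^+ 2 * (x + C * z)) ^+ 2 by ring.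
have G2 : d ^+ 2 * (edge A x y * edge C z x - corner A B C x y z ^+ 2) = 0.
  have -> : d ^+ 2 * (edge A x y * edge C z x - corner A B C x y z ^+ 2) =
    (d * edge A x y) * (d * edge C z x) - (- (d * corner A B C x y z)) ^+ 2 by ring.
  by rewrite -e0 -e2 -p02; ring.
rewrite p02 e0.
have -> : (- (d * corner A B C x y z) * (x + A * y)
           + d * edge A x y * (x + C * z)) ^+ 2 =
  d ^+ 2 * (corner A B C x y z * (x + A * y) - edge A x y * (x + C * z)) ^+ 2.
  by ring.
rewrite corner_sqr mulrDr [X in _ + X]mulrCA G2; ring.
Qed.

(** Heron's formula: the product of the four factors is 4 d^2 times the Gram determinant of two
    sides, which is zero here. *)
Lemma collinear_heron d A B C x y z p0 p1 p2 :
    edge A x y * edge C z x = corner A B C x y z ^+ 2 -> p0 ^+ 2 = d * edge A x y ->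
    p1 ^+ 2 = d * edge B y z -> p2 ^+ 2 = d * edge C z x ->
  (p0 + p1 + p2) * (p0 + p1 - p2) * (p0 - p1 + p2) * (p1 + p2 - p0) = 0.
Proof.
move=> e e0 e1 e2.
transitivity ((2 * d) ^+ 2 * (edge A x y * edge C z x)
              - (d * (edge A x y + edge C z x - edge B y z)) ^+ 2).
  have -> : (2 * d) ^+ 2 * (edge A x y * edge C z x) =
    4 * (d * edge A x y * (d * edge C z x)) by ring.
  have -> : d * (edge A x y + edge C z x - edge B y z) =
    d * edge A x y + d * edge C z x - d * edge B y z by ring.
  by rewrite -e0 -e1 -e2; ring.
by rewrite e -cornerE; ring.
Qed.

(** The adjugate of a singular 3 by 3 matrix has rank at most 1, so its form is a multiple of the
    square of a linear form. *)
Lemma adj_form_degenerate A B C x y z : gram_det A B C = 0 ->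
  (1 - B ^+ 2) * adj_form A B C x y z x y z =
  ((1 - B ^+ 2) * x + (A + B * C) * y + (C + A * B) * z) ^+ 2.
Proof.
move=> D0; apply/eqP; rewrite -subr_eq0; apply/eqP.
transitivity (gram_det A B C * edge B y z); last by rewrite D0 mul0r.
rewrite /adj_form /gram_det /edge; ring.
Qed.

(** On the kernel of that linear form the normalized edges agree; for conjugate arguments this makes
    [edge A x y / (1 - A ^+ 2)] invariant under Frobenius. *)
Lemma edge_degenerate A B C x y z : gram_det A B C = 0 -> 1 - B ^+ 2 != 0 ->
  (1 - B ^+ 2) * x + (A + B * C) * y + (C + A * B) * z = 0 ->
  (1 - B ^+ 2) * edge A x y = (1 - A ^+ 2) * edge B y z.
Proof.
move=> D0 B1 l0; apply/(mulfI B1)/eqP; rewrite -subr_eq0; apply/eqP.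
transitivity (((1 - B ^+ 2) * x + (A + B * C) * y + (C + A * B) * z)
  * ((1 - B ^+ 2) * x - (A + B * C) * y - (C + A * B) * z
     + 2 * A * (1 - B ^+ 2) * y) - gram_det A B C * (B * y + z) ^+ 2).
  by rewrite /gram_det /edge; ring.
by rewrite l0 D0; ring.
Qed.

(** [Delta] as a polynomial in the three conjugates of N. *)
Definition norm_poly (N0 N1 N2 : K) :=
  (N0 * N1 * N2) ^+ 2
  - 2 * ((N0 * N1 * N2) * N0 + (N0 * N1 * N2) * N1 + (N0 * N1 * N2) * N2)
  + N0 ^+ 2 + N1 ^+ 2 + N2 ^+ 2 + 8 * (N0 * N1 * N2)
  - 2 * (N0 * N1 + N1 * N2 + N0 * N2).

Lemma rmorph_norm_poly (f : {rmorphism K -> K}) N0 N1 N2 :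
  f (norm_poly N0 N1 N2) = norm_poly (f N0) (f N1) (f N2).
Proof.
by rewrite /norm_poly !(rmorph_nat, rmorphXn, rmorphM, rmorphN, rmorphD).
Qed.

Lemma norm_poly_rot N0 N1 N2 : norm_poly N1 N2 N0 = norm_poly N0 N1 N2.
Proof. rewrite /norm_poly; ring. Qed.

Lemma gram_det_cayley N0 N1 N2 : N0 != 1 -> N1 != 1 -> N2 != 1 ->
  let c N := (N + 1) / (N - 1) in
  4 * norm_poly N0 N1 N2 =
  - gram_det (c N0) (c N1) (c N2) * ((N0 - 1) * (N1 - 1) * (N2 - 1)) ^+ 2.
Proof.
move=> N0_1 N1_1 N2_1 c; rewrite /norm_poly /gram_det /c; field.
by rewrite !subr_eq0 N0_1 N1_1 N2_1.
Qed.

Lemma one_sub_cayley_sqr N : N != 1 ->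
  1 - ((N + 1) / (N - 1)) ^+ 2 = - (4 * N) / (N - 1) ^+ 2.
Proof. by move=> N1; field; rewrite subr_eq0. Qed.

Lemma cross_ratio_edge N d r x y : N != 1 ->
  (N * (r ^+ 2 - d * (x + y) ^+ 2) = r ^+ 2 - d * (x - y) ^+ 2) <->
  r ^+ 2 = d * edge ((N + 1) / (N - 1)) x y.
Proof.
move=> N1; have N1' : N - 1 != 0 by rewrite subr_eq0.
have E : (N - 1) * (r ^+ 2 - d * edge ((N + 1) / (N - 1)) x y) =
  N * (r ^+ 2 - d * (x + y) ^+ 2) - (r ^+ 2 - d * (x - y) ^+ 2).
  by rewrite /edge; field.
split=> [e|e]; apply/eqP; rewrite -subr_eq0; last by rewrite -E e subrr mulr0.
by rewrite -(mulrI_eq0 _ (mulfI N1')) E e subrr.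
Qed.

End Collinearity.

(** * From scattered subspaces to witnesses over the cubic subfield *)

Section Scattered.
Variables (F : finFieldType) (L : fieldExtType F).
Implicit Types b c d r s t x y z w N : L.

Lemma scattered_UbP b : scattered (Ub b) <->
  forall x t, x != 0 -> frob 1 t != t ->
    b * frob 1 x * (frob 1 t - t) != frob 4 x * (t - frob 4 t).
Proof.
pose f x := b * frob 1 x + frob 4 x.
have memU v : v \in Ub b -> v.2 = f v.1.
  by case/UbP=> x ->; rewrite /f /frob expn1.
have memUf x : (x, f x) \in Ub b.
  by apply/UbP; exists x; rewrite /f /frob expn1.
have collinear x t : f (t * x) = t * f x <->
    b * frob 1 x * (frob 1 t - t) = frob 4 x * (t - frob 4 t).
  have E : f (t * x) - t * f x =
    b * frob 1 x * (frob 1 t - t) - frob 4 x * (t - frob 4 t).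
    by rewrite /f !rmorphM /=; ring.
  by split=> e; apply/eqP; rewrite -subr_eq0; [rewrite -E | rewrite E];
    rewrite e subrr.
split=> [U_scat x t x_neq0 t_notin | no_xt u u_neq0].
  apply: contraNneq t_notin => /collinear ft.
  pose v : L * L := (x, f x).
  have v_neq0 : v != 0 by apply: contraNneq x_neq0 => /(congr1 fst) /= ->.
  have := U_scat v v_neq0.
  have vW : v \in (Ub b :&: lineL v)%VS.
    by rewrite memv_cap memUf; apply/lineLP; exists 1; rewrite !mul1r.
  have tvW : (t * x, t * f x) \in (Ub b :&: lineL v)%VS.
    by rewrite memv_cap -{1}ft memUf; apply/lineLP; exists t.
  have lineW : (<[v]> <= Ub b :&: lineL v)%VS by rewrite -memvE.
  move=> dimW; have /eqP lineE : <[v]>%VS == (Ub b :&: lineL v)%VS.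
    by rewrite eqEdim lineW dim_vline v_neq0.
  move: tvW; rewrite -lineE => /vlineP[a [tx _]].
  have -> : t = a%:A by apply: (mulIf x_neq0); rewrite tx mulr_algl.
  by rewrite linearZ rmorph1.
rewrite leqNgt; apply/negP=> dimW.
have [v vW v_neq0] := dim_gt0_neq0 (ltnW dimW).
have [v' v'W v'_notin] : exists2 v', v' \in (Ub b :&: lineL u)%VS & v' \notin <[v]>%VS.
  apply/subvPn; apply: contraL dimW => /dimvS.
  by rewrite dim_vline v_neq0 -leqNgt.
move: vW v'W; rewrite !memv_cap => /andP[/memU v2 /lineLP[c vE]].
case/andP=> /memU v'2 /lineLP[c' v'E].
have x_neq0 : v.1 != 0.
  apply: contraNneq v_neq0 => x0; rewrite [v]surjective_pairing v2 x0.
  by rewrite /f !rmorph0 mulr0 addr0.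
have c_neq0 : c != 0 by apply: contraNneq x_neq0 => c0; rewrite vE c0 mul0r.
have v'1 : v'.1 = c' / c * v.1 by rewrite vE v'E /= mulrA divfK.
have t_notin : frob 1 (c' / c) != c' / c.
  apply: contraNneq v'_notin => /eqP; rewrite -mem_base_field => /vlineP[a tE].
  apply/vlineP; exists a; rewrite [v']surjective_pairing [v]surjective_pairing.
  congr pair; first by rewrite v'1 tE mulr_algl.
  by rewrite vE v'E /= -[RHS]mulr_algl -tE mulrA divfK.
have /eqP[] := no_xt v.1 _ x_neq0 t_notin; apply/collinear.
by rewrite -v'1 -v'2 -v2 vE v'E /= mulrA divfK.
Qed.

Hypothesis q_odd : odd #|F|.
Hypothesis dimL : \dim {:L} = 6%N.

Definition cubic_subfield : {vspace L} := lker (linfun (@frob F L 3) - \1)%VF.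

Lemma mem_cubic x : (x \in cubic_subfield) = (frob 3 x == x).
Proof. by rewrite memv_ker add_lfunE opp_lfunE !lfunE subr_eq0. Qed.

Lemma frob3_antifixed w : frob 1 w = - w -> frob 3 w = - w.
Proof.
move=> w1; rewrite -(frob_comp 1 2) -(frob_comp 1 1) w1 !rmorphN /= w1.
by rewrite !rmorphN /= w1 opprK.
Qed.

(** Splits t into eigenvectors of the involution [frob 3], using that w lies in the eigenspace of
    -1. *)
Lemma cubic_decomposition w t : w != 0 -> frob 1 w = - w ->
  exists r s, [/\ frob 3 r = r, frob 3 s = s & t = r + w * s].
Proof.
move=> w_neq0 w1; have two0 := two_neq0 L q_odd.
have t6 : frob 3 (frob 3 t) = t by rewrite frob_comp frob6.
exists ((t + frob 3 t) / 2), ((t - frob 3 t) / (2 * w)); split.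
- by rewrite fmorph_div rmorphD /= t6 rmorph_nat addrC.
- rewrite fmorph_div rmorphM rmorphB /= t6 rmorph_nat (frob3_antifixed w1).
  by field; rewrite oppr_eq0 two0 w_neq0.
- by field; rewrite w_neq0 two0.
Qed.

(** The decomposition writes L as K + wK with K the cubic subfield, so 6 is at most twice the
    dimension of K. *)
Lemma dim_cubic : (2 < \dim cubic_subfield)%N.
Proof.
have [w w_neq0 w1] := exists_antifixed q_odd dimL.
have sub : ({:L} <= cubic_subfield + <[w]> * cubic_subfield)%VS.
  apply/subvP=> t _; have [r [s [r3 s3 ->]]] := cubic_decomposition t w_neq0 w1.
  by rewrite memv_add ?memv_mul ?memv_line // mem_cubic ?r3 ?s3.
have := dimvS sub; rewrite dimL => le6.
have le_dim : (\dim (<[w]> * cubic_subfield) <= \dim cubic_subfield)%N.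
  by have := dim_prodv <[w]> cubic_subfield; rewrite dim_vline w_neq0 mul1n.
have := leq_trans le6 (dimv_add_leqif _ _).
move=> /leq_trans/(_ (leq_add (leqnn _) le_dim)).
by rewrite addnn -[6%N]/(3.*2)%N leq_double.
Qed.

Lemma exists_cubic_not_base : exists2 c : L, frob 3 c = c & frob 1 c != c.
Proof.
have [c] : exists2 c, c \in cubic_subfield & c \notin 1%VS.
  apply/subvPn; apply: contraL dim_cubic => /dimvS.
  by rewrite dimv1 -leqNgt => /leq_trans; apply.
by rewrite mem_cubic mem_base_field => /eqP c3; exists c.
Qed.

(* Additive Hilbert 90; an element c of nonzero trace replaces 1, whose trace
   vanishes in characteristic 3. *)
Lemma trace0_frob_sub (r : L) : frob 3 r = r -> r + frob 1 r + frob 2 r = 0 ->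
  exists2 y, frob 3 y = y & r = frob 1 y - y.
Proof.
move=> r3 r_tr.
pose tr (y : L) := y + frob 1 y + frob 2 y.
have f1f2 (y : L) : frob 1 (frob 2 y) = frob 3 y := frob_comp 1 2 y.
have f1f1 (y : L) : frob 1 (frob 1 y) = frob 2 y := frob_comp 1 1 y.
have [c c3 trc] : exists2 c : L, frob 3 c = c & tr c != 0.
  have [c c3 c1] := exists_cubic_not_base.
  have [t1|] := eqVneq (tr 1) 0; last by exists 1; rewrite // rmorph1.
  have [tc|] := eqVneq (tr c) 0; last by exists c.
  have [tcc|] := eqVneq (tr (c ^+ 2)) 0; last
    by exists (c ^+ 2); rewrite ?rmorphXn /= ?c3.
  (* If 1, c and c^2 all had trace zero, then 3 = 0 and the two other traces would force (c_1 - c)^2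
     = 0. *)
  case/eqP: c1; apply/eqP; rewrite -subr_eq0 -sqrf_eq0; apply/eqP.
  have three0 : 3 = 0 :> L by rewrite -t1 /tr !rmorph1; ring.
  move: tc tcc; rewrite /tr !rmorphXn /= => tc tcc.
  transitivity (3 * (c ^+ 2 + frob 1 c ^+ 2)
    - (c ^+ 2 + frob 1 c ^+ 2 + frob 2 c ^+ 2)
    + (frob 2 c - c - frob 1 c) * (c + frob 1 c + frob 2 c)); first by ring.
  by rewrite tc tcc three0; ring.
have tr1 : frob 1 (tr c) = tr c by rewrite /tr !rmorphD /= f1f1 f1f2 c3; ring.
have r2 : frob 2 r = - (r + frob 1 r) by rewrite -[LHS]subr0 -r_tr; ring.
(* Partial sums of the conjugates of r, weighted by conjugates of c and normalized by the trace of
   c. *)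
pose y := - (r * frob 1 c + (r + frob 1 r) * frob 2 c) / tr c.
have y1 : frob 1 y = (r * c - frob 1 r * frob 2 c) / tr c.
  rewrite /y fmorph_div /= tr1 rmorphN rmorphD !rmorphM rmorphD /=.
  by rewrite !f1f1 f1f2 c3 r2; congr (_ / _); ring.
exists y; last by rewrite y1 /y /tr; field.
have y2 : frob 2 y = (frob 1 r * frob 1 c - frob 2 r * c) / tr c.
  by rewrite -f1f1 y1 fmorph_div /= tr1 rmorphB !rmorphM /= f1f2 c3 f1f1.
rewrite -f1f2 y2 fmorph_div /= tr1 rmorphB !rmorphM /= !f1f1 f1f2 r3 /y r2.
by congr (_ / _); ring.
Qed.

(* Encodes t = r' + w s with r = frob 1 r' - r' and d = w ^+ 2. *)
Definition witness (N d r s : L) := [/\ frob 3 r = r, frob 3 s = s,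
  (r != 0) || (s != 0), r + frob 1 r + frob 2 r = 0 &
  N * (r ^+ 2 - d * (s + frob 1 s) ^+ 2) = r ^+ 2 - d * (s - frob 1 s) ^+ 2].

(** The element 1 + z_3 works by direct computation unless it vanishes; then z = -1 and w serves. *)
Lemma hilbert90_frob3 w z : w != 0 -> frob 1 w = - w -> z * frob 3 z = 1 ->
  exists2 y, y != 0 & frob 3 y = z * y.
Proof.
move=> w_neq0 w1 zz; have z6 : frob 3 (frob 3 z) = z by rewrite frob_comp frob6.
have [z3|z3] := eqVneq (1 + frob 3 z) 0.
  exists w => //; rewrite frob3_antifixed // -z6.
  have -> : frob 3 z = -1 by apply/eqP; rewrite -addr_eq0 addrC z3.
  by rewrite rmorphN1 mulN1r.
by exists (1 + frob 3 z) => //; rewrite rmorphD rmorph1 /= z6 mulrDr zz mulr1 addrC.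
Qed.

(** The equation reads [frob 3] x_1 = z x_1 with z = b (t_1 - t) / (t - t_4), and it is solvable
    exactly when z z_3 = 1. For necessity, multiplying the equation by its image under [frob 3]
    eliminates x. *)
Lemma scattered_cross_ratio b t : b != 0 -> frob 1 t != t ->
  (exists2 x, x != 0 & b * frob 1 x * (frob 1 t - t) = frob 4 x * (t - frob 4 t))
  <-> b * frob 3 b * ((frob 1 t - t) * (frob 4 t - frob 3 t))
      = (t - frob 4 t) * (frob 3 t - frob 1 t).
Proof.
move=> b_neq0 t_notin; have t1 : frob 1 t - t != 0 by rewrite subr_eq0.
have f1 y : frob 3 (frob 1 y) = frob 4 y := frob_comp 3 1 y.
have f4 (y : L) : frob 3 (frob 4 y) = frob 1 y by rewrite frob_comp frob7.
split=> [[x x_neq0 e]|e].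
  have e3 : frob 3 b * frob 4 x * (frob 4 t - frob 3 t) =
            frob 1 x * (frob 3 t - frob 1 t).
    by have := congr1 (frob 3) e; rewrite !rmorphM !rmorphB /= f1 f4 f1 f4.
  have c0 : frob 1 x * frob 4 x != 0 by rewrite mulf_neq0 // fmorph_eq0.
  apply/(mulfI c0).
  transitivity ((b * frob 1 x * (frob 1 t - t)) *
                (frob 3 b * frob 4 x * (frob 4 t - frob 3 t))); first by ring.
  by rewrite e e3; ring.
have t43 : frob 4 t - frob 3 t != 0 by rewrite -f1 -rmorphB fmorph_eq0.
have t4 : t - frob 4 t != 0.
  apply: contraTneq isT => t4; have := mulf_neq0 (mulf_neq0 b_neq0 _) (mulf_neq0 t1 t43).
  by move=> /(_ (frob 3 b)); rewrite e t4 mul0r eqxx fmorph_eq0 => /(_ b_neq0).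
have [w w_neq0 w1] := exists_antifixed q_odd dimL.
have t31 : frob 3 t - frob 1 t != 0 by rewrite -(f4 t) -rmorphB fmorph_eq0.
pose z := b * (frob 1 t - t) / (t - frob 4 t).
have zz : z * frob 3 z = 1.
  rewrite /z fmorph_div rmorphM !rmorphB /= f1 f4.
  have -> : b * (frob 1 t - t) / (t - frob 4 t) *
    (frob 3 b * (frob 4 t - frob 3 t) / (frob 3 t - frob 1 t)) =
    b * frob 3 b * ((frob 1 t - t) * (frob 4 t - frob 3 t))
    / ((t - frob 4 t) * (frob 3 t - frob 1 t)).
    by field; rewrite t31 t4.
  by rewrite e divff // mulf_neq0.
have [y y_neq0 yz] := hilbert90_frob3 w_neq0 w1 zz.
have f5 : frob 1 (frob 5 y) = y by rewrite frob_comp frob6.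
(* [frob 5] is the inverse of [frob 1], so that x_1 = y. *)
exists (frob 5 y); first by rewrite fmorph_eq0.
rewrite -(f1 (frob 5 y)) f5 yz /z; field.
by rewrite t4.
Qed.

Lemma scattered_witness b w : b != 0 -> w != 0 -> frob 1 w = - w ->
  scattered (Ub b) <-> forall r s, ~ witness (b * frob 3 b) (w ^+ 2) r s.
Proof.
move=> b_neq0 w_neq0 w1; set N := b * frob 3 b.
have w3 := frob3_antifixed w1.
have w4 : frob 4 w = w by rewrite -(frob_comp 1 3) w3 rmorphN /= w1 opprK.
have f4 y : frob 3 y = y -> frob 4 y = frob 1 y.
  by move=> y3; rewrite -(frob_comp 1 3) y3.
have f31 y : frob 3 y = y -> frob 3 (frob 1 y) = frob 1 y.
  by move=> y3; rewrite frob_comp -(frob_comp 1 3) y3.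
have tE r s : frob 3 r = r -> frob 3 s = s -> let t := r + w * s in
  [/\ frob 1 t = frob 1 r - w * frob 1 s, frob 3 t = r - w * s
    & frob 4 t = frob 1 r + w * frob 1 s].
  move=> r3 s3 t; rewrite /t !rmorphD !rmorphM /= w1 w3 w4 r3 s3 !f4 //.
  by rewrite !mulNr.
(* Both products are norms of the form u u_3 from L to the cubic subfield, hence differences of
   squares in the coordinates 1 and w. *)
have crossE r s : frob 3 r = r -> frob 3 s = s -> let t := r + w * s in
  let p := frob 1 r - r in
  N * ((frob 1 t - t) * (frob 4 t - frob 3 t)) = (t - frob 4 t) * (frob 3 t - frob 1 t)
  <-> N * (p ^+ 2 - w ^+ 2 * (s + frob 1 s) ^+ 2) = p ^+ 2 - w ^+ 2 * (s - frob 1 s) ^+ 2.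
  move=> r3 s3 t p; have [-> -> ->] := tE r s r3 s3; rewrite /t /p.
  have -> : (frob 1 r - w * frob 1 s - (r + w * s)) *
            (frob 1 r + w * frob 1 s - (r - w * s))
    = (frob 1 r - r) ^+ 2 - w ^+ 2 * (s + frob 1 s) ^+ 2 by ring.
  have -> : (r + w * s - (frob 1 r + w * frob 1 s)) *
            (r - w * s - (frob 1 r - w * frob 1 s))
    = (frob 1 r - r) ^+ 2 - w ^+ 2 * (s - frob 1 s) ^+ 2 by ring.
  by [].
rewrite scattered_UbP; split=> [U_scat p s [p3 s3 ps p_tr e] | no_wit x t x_neq0 t_notin].
  have [r r3 pE] := trace0_frob_sub p3 p_tr.
  have t_notin : frob 1 (r + w * s) != r + w * s.
    apply: contraTneq ps => t1.
    have [t1E t3 _] := tE r s r3 s3.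
    have s0 : s = 0.
      have : frob 3 (r + w * s) = r + w * s.
        by rewrite -(frob_comp 1 2) -(frob_comp 1 1) !t1.
      rewrite t3 => /addrI/eqP; rewrite eq_sym -subr_eq0 opprK -mulr2n.
      rewrite -mulr_natl mulf_eq0 (negbTE (two_neq0 L q_odd)) mulf_eq0.
      by rewrite (negbTE w_neq0) => /eqP.
    by move: t1; rewrite pE s0 mulr0 addr0 => ->; rewrite subrr eqxx.
  rewrite pE in e; move/(crossE r s r3 s3)/(scattered_cross_ratio b_neq0 t_notin): e.
  by case=> x x_neq0 ex; have /eqP := U_scat x _ x_neq0 t_notin.
apply/eqP=> e.
have /(scattered_cross_ratio b_neq0 t_notin) : exists2 x, x != 0 &
    b * frob 1 x * (frob 1 t - t) = frob 4 x * (t - frob 4 t) by exists x.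
have [r [s [r3 s3 tE']]] := cubic_decomposition t w_neq0 w1.
rewrite tE' => /(crossE r s r3 s3) ew; apply: (no_wit (frob 1 r - r) s); split=> //.
- by rewrite rmorphB /= f31 // r3.
- apply: contraNT t_notin; rewrite negb_or !negbK subr_eq0 => /andP[/eqP r1 /eqP s0].
  by rewrite tE' s0 mulr0 addr0 r1.
- rewrite !rmorphB /= !frob_comp.
  rewrite -[(1 + 1)%N]/2%N -[(1 + 2)%N]/3%N r3; ring.
Qed.

End Scattered.

(** * Descent of values to F, and the expression of [Delta] by conjugates *)

Section Criterion.
Variables (F : finFieldType) (L : fieldExtType F).
Implicit Types b c d r s t x y z w N : L.

Lemma frob_combination k (a : F) x y :
  frob k (a *: x + y) = a%:A * frob k x + frob k y.
Proof. by rewrite frob_linear mulr_algl. Qed.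

(** Brings Frobenius-fixed elements down to F. Being linear on all of L, it turns L-valued bilinear
    forms into F-valued ones. *)
Definition base_coord : L -> F := coord [tuple (1 : L)] 0.

Lemma base_coordK x : frob 1 x = x -> (base_coord x)%:A = x.
Proof.
move/eqP; rewrite -mem_base_field => /vlineP[a ->].
have free1 : free [tuple (1 : L)] by rewrite seq1_free oner_neq0.
have coord1 : base_coord 1 = 1 := coord_free 0 0 free1.
by rewrite /base_coord linearZ /= -/(base_coord 1) coord1; congr (_ *: _); apply: mulr1.
Qed.

Lemma base_coord_linear : linear (base_coord : L -> F^o).
Proof. by move=> a x y; rewrite /base_coord linearP. Qed.

Lemma Delta_norm_poly b : let N := b * frob 3 b in
  Delta b = norm_poly N (frob 1 N) (frob 2 N).
Proof.
move=> N; rewrite /Delta.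
have -> : b ^+ (#|F| ^ 3 + 1) = N by rewrite exprD expr1 mulrC.
have -> : frob 1 N = N ^+ #|F| by rewrite /frob expn1.
(* With q^2 as an independent exponent, the powers of N become monomials in its conjugates. *)
rewrite -[frob 2 N]/(N ^+ (#|F| ^ 2)); move: (#|F| ^ 2)%N => q2.
by rewrite /norm_poly !(mulnDr, mulnC 2%N) !exprD !exprM !expr1; ring.
Qed.

Hypothesis q_odd : odd #|F|.
Hypothesis dimL : \dim {:L} = 6%N.

Lemma dim_Ub b : \dim (Ub b) = 6%N.
Proof.
rewrite -dimL; apply: limg_dim_eq; apply/eqP; rewrite -subv0.
apply/subvP=> x /memv_capP[_]; rewrite memv_ker lfunE => /eqP[-> _].
exact: mem0v.
Qed.

Lemma neg_fix_eq0 x : - x = x -> x = 0.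
Proof.
move=> xN; apply/(mulfI (two_neq0 L q_odd)).
by rewrite mulr0 mulr_natl mulr2n -{1}xN addNr.
Qed.

Lemma frob_neg_fix z : frob 1 z = - z -> frob 3 z = z -> z = 0.
Proof. by move=> /frob3_antifixed-> /neg_fix_eq0. Qed.

(** An extension of odd degree contains no new square roots: z_1 = -z would give z_3 = -z, hence z =
    0. *)
Lemma frob1_of_sqr z : frob 3 z = z -> frob 1 (z ^+ 2) = z ^+ 2 -> frob 1 z = z.
Proof.
move=> z3; rewrite rmorphXn /= => /eqP; rewrite eqf_sqr => /orP[/eqP //|/eqP z1].
by rewrite (frob_neg_fix z1 z3) rmorph0.
Qed.

(** * Existence and exclusion of witnesses when N differs from 0 and 1 *)

Section NonTrivial.
Variables (N A w : L).
Hypotheses (N3 : frob 3 N = N) (N_neq0 : N != 0) (N_neq1 : N != 1).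
Hypothesis AE : A = (N + 1) / (N - 1).
Hypotheses (w_neq0 : w != 0) (w1 : frob 1 w = - w).

Let f11 x : frob 1 (frob 1 x) = frob 2 x := frob_comp 1 1 x.
Let f12 x : frob 1 (frob 2 x) = frob 3 x := frob_comp 1 2 x.
Let f31 x : frob 3 x = x -> frob 3 (frob 1 x) = frob 1 x.
Proof. by move=> x3; rewrite frob_comp -(frob_comp 1 3) x3. Qed.
Let f32 x : frob 3 x = x -> frob 3 (frob 2 x) = frob 2 x.
Proof. by move=> x3; rewrite frob_comp -(frob_comp 2 3) x3. Qed.
Let two0 : 2 != 0 :> L := two_neq0 L q_odd.
Let A1 := frob 1 A.
Let A2 := frob 2 A.
Let D := gram_det A A1 A2.
Let d := w ^+ 2.
Let d1 : frob 1 d = d. Proof. by rewrite rmorphXn /= w1 sqrrN. Qed.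
Let d_neq0 : d != 0. Proof. by rewrite expf_neq0. Qed.
Let A3 : frob 3 A = A.
Proof. by rewrite AE fmorph_div rmorphB rmorphD rmorph1 /= N3. Qed.
Let Pi := (N - 1) * (frob 1 N - 1) * (frob 2 N - 1).

Let frob1_edge B x y : frob 1 (edge B x y) = edge (frob 1 B) (frob 1 x) (frob 1 y).
Proof. exact: rmorph_edge. Qed.

Let edges1 r s : frob 3 s = s -> r ^+ 2 = d * edge A s (frob 1 s) ->
  frob 1 r ^+ 2 = d * edge A1 (frob 1 s) (frob 2 s) /\
  frob 2 r ^+ 2 = d * edge A2 (frob 2 s) s.
Proof.
move=> s3 e; have e1 : frob 1 r ^+ 2 = d * edge A1 (frob 1 s) (frob 2 s).
  by rewrite -rmorphXn e rmorphM /= frob1_edge d1 f11.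
split=> //; rewrite -f11 -rmorphXn /= e1 rmorphM /= frob1_edge d1 f11 f12 s3.
by rewrite /A1 f11.
Qed.

Let fN_neq1 k : frob k N != 1.
Proof. by rewrite -(rmorph1 (frob k)) (inj_eq (fmorph_inj _)). Qed.

Let Pi_neq0 : Pi != 0.
Proof. by rewrite !mulf_neq0 // subr_eq0. Qed.

Let Pi3 : frob 3 Pi = Pi.
Proof.
by rewrite !rmorphM !rmorphB !rmorph1 /= N3 f31 // f32.
Qed.

(** By [collinear_sides] a witness yields M in the cubic subfield with (M Pi)^2 = (2 v s_1 s_2 w)^2.
    The left root is fixed by [frob 3], while the right one is nonzero and changes sign. *)
Lemma not_witness_of_square (v : L) r s : frob 1 v = v -> v != 0 ->
  (2 * v) ^+ 2 = - D * Pi ^+ 2 -> ~ witness N d r s.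
Proof.
move=> v1 v_neq0 vD [r3 s3 rs r_tr /(cross_ratio_edge _ _ _ _ N_neq1) e].
rewrite -AE in e.
have D_neq0 : D != 0.
  apply: contra_eq_neq vD => ->.
  by rewrite oppr0 mul0r expf_neq0 ?mulf_neq0.
have [e1 e2] := edges1 s3 e.
have s_neq0 : s != 0.
  apply: contraTneq rs => s0; rewrite s0 eqxx orbF negbK -sqrf_eq0 e s0.
  by rewrite /edge rmorph0 !mulr0 expr0n !addr0 mulr0.
have s1_neq0 : frob 1 s != 0 by rewrite fmorph_eq0.
have s2_neq0 : frob 2 s != 0 by rewrite fmorph_eq0.
(* If r vanished, so would all three sides, and [edges_eq0] would give D = 0. *)
have r_neq0 : r != 0.
  apply: contraNneq D_neq0 => r0; apply/eqP.
  move: e e1 e2; rewrite r0 !rmorph0 expr0n /= => e e1 e2.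
  apply: (edges_eq0 two0 s_neq0 s1_neq0 s2_neq0); apply: (mulfI d_neq0);
    by rewrite mulr0.
have := collinear_sides two0 r_tr e e1 e2 r_neq0.
set M := _ * _ + _ => eM.
have M3 : frob 3 M = M.
  by rewrite rmorphD !rmorphM !rmorphD !rmorphM /= A3 r3 s3 !f31 // !f32.
have : (M * Pi) ^+ 2 == (2 * v * (frob 1 s * frob 2 s) * w) ^+ 2.
  apply/eqP; transitivity ((2 * v) ^+ 2 * d * (frob 1 s * frob 2 s) ^+ 2).
    by rewrite vD exprMn eM -/D; ring.
  by rewrite /d; ring.
have K3 : frob 3 (2 * v * (frob 1 s * frob 2 s)) = 2 * v * (frob 1 s * frob 2 s).
  rewrite !rmorphM rmorph_nat /= f31 // f32 //; congr (_ * _ * _).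
  by rewrite -(frob_comp 1 2) -(frob_comp 1 1) !v1.
have K_neq0 : 2 * v * (frob 1 s * frob 2 s) * w != 0.
  by rewrite !mulf_neq0.
have w3 := frob3_antifixed w1.
have MP3 : frob 3 (M * Pi) = M * Pi by rewrite rmorphM /= M3 Pi3.
rewrite eqf_sqr => /orP[] /eqP MP; move: MP3; rewrite MP ?rmorphN rmorphM /= K3 w3 mulrN.
  by move/neg_fix_eq0/eqP; rewrite (negbTE K_neq0).
by rewrite opprK => /esym/neg_fix_eq0/eqP; rewrite (negbTE K_neq0).
Qed.

(** Isotropy of z makes the triangle with s = 1/z degenerate, and the condition on y puts r = w y in
    the cubic subfield. *)
Lemma witness_of_isotropic z y : frob 3 z = z -> z != 0 ->
    adj_form A A1 A2 z (frob 1 z) (frob 2 z) z (frob 1 z) (frob 2 z) = 0 ->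
    edge A z^-1 (frob 1 z^-1) = y ^+ 2 -> frob 3 y = - y ->
  witness N d (w * y) z^-1.
Proof.
move=> z3 z_neq0 Q0 ey y3; set s := z^-1; set r := w * y.
have s_neq0 : s != 0 by rewrite invr_eq0.
have s3 : frob 3 s = s by rewrite fmorphV /= z3.
have r3 : frob 3 r = r by rewrite rmorphM /= (frob3_antifixed w1) y3 mulrNN.
have e : r ^+ 2 = d * edge A s (frob 1 s) by rewrite exprMn -ey.
have [e1 e2] := edges1 s3 e.
split=> //; first by rewrite s_neq0 orbT.
  have G0 : edge A s (frob 1 s) * edge A2 (frob 2 s) s =
      corner A A1 A2 s (frob 1 s) (frob 2 s) ^+ 2.
    apply/eqP; rewrite -subr_eq0 edges_adj_form ?fmorph_eq0 //.
    by rewrite /s -!fmorphV /= invrK Q0 mulr0.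
  have two_r x : x + x = 0 -> x = 0.
    by move/eqP; rewrite addr_eq0 => /eqP/esym/neg_fix_eq0.
  have r0 : r = 0 -> r + frob 1 r + frob 2 r = 0.
    by move=> ->; rewrite !rmorph0 !addr0.
  have f2 : frob 1 (frob 2 r) = r by rewrite f12.
  have /eqP := collinear_heron G0 e e1 e2.
  (* One Heron factor is the desired trace. Any other, added to its Frobenius conjugate, leaves
     twice a conjugate of r, so r = 0 and the trace vanishes anyway. *)
  rewrite !mulf_eq0 -!orbA => /or4P[] /eqP h //; apply: r0.
  - have := congr1 (frob 1) h; rewrite rmorphB rmorphD rmorph0 /= f11 f2 => h1.
    apply/(fmorph_inj (frob 1)); rewrite rmorph0; apply: two_r.
    transitivity ((r + frob 1 r - frob 2 r) + (frob 1 r + frob 2 r - r)).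
      by ring.
    by rewrite h h1 addr0.
  - have := congr1 (frob 1) h; rewrite rmorphD rmorphB rmorph0 /= f11 f2 => h1.
    apply: two_r.
    transitivity ((r - frob 1 r + frob 2 r) + (frob 1 r - frob 2 r + r)).
      by ring.
    by rewrite h h1 addr0.
  - have := congr1 (frob 1) h; rewrite rmorphB rmorphD rmorph0 /= f11 f2 => h1.
    apply/(fmorph_inj (frob 2)); rewrite rmorph0; apply: two_r.
    transitivity ((frob 1 r + frob 2 r - r) + (frob 2 r + r - frob 1 r)).
      by ring.
    by rewrite h h1 addr0.
by apply/cross_ratio_edge; rewrite // -AE.
Qed.

Let edgeV x y : x != 0 -> y != 0 ->
  edge A x^-1 y^-1 = edge A x y / (x * y) ^+ 2.
Proof. by move=> x0 y0; rewrite /edge; field; rewrite x0 y0. Qed.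

Let frob_one_sub_sqr k : frob k (1 - A ^+ 2) = 1 - frob k A ^+ 2.
Proof. by rewrite rmorphB rmorphXn rmorph1. Qed.

Let cayley_neq k : 1 - frob k A ^+ 2 != 0.
Proof.
rewrite -frob_one_sub_sqr fmorph_eq0 AE.
rewrite one_sub_cayley_sqr // mulf_neq0 ?invr_eq0 ?expf_neq0 ?subr_eq0 //.
by rewrite oppr_eq0 mulf_neq0 // -[4]/((2 * 2)%:R) natrM mulf_neq0.
Qed.

(** The square of the linear form l is a constant times Q, whose values lie in F. Ratios of values
    of l thus have squares in F, so they lie in F themselves; the image of l is at most a line and
    its kernel at least a plane. *)
Lemma dim_isotropic_plane : D = 0 -> exists W : {vspace L},
  [/\ (1 < \dim W)%N, (W <= cubic_subfield L)%VS & forall z, z \in W ->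
    (1 - A1 ^+ 2) * z + (A + A1 * A2) * frob 1 z + (A2 + A * A1) * frob 2 z = 0].
Proof.
move=> D0.
pose l z := (1 - A1 ^+ 2) * z + (A + A1 * A2) * frob 1 z + (A2 + A * A1) * frob 2 z.
have l_lin : linear l.
  move=> a x y; rewrite /l !frob_combination -[a *: x]mulr_algl.
  by rewrite -[a *: (_ + _)]mulr_algl; move: a%:A => c; ring.
pose lin := GRing.isLinear.Build F L L _ _ l_lin.
pose f : {linear L -> L} := HB.pack l lin.
have fE z : linfun f z = l z by rewrite lfunE.
pose Q z := adj_form A A1 A2 z (frob 1 z) (frob 2 z) z (frob 1 z) (frob 2 z).
have lQ z : (1 - A1 ^+ 2) * Q z = l z ^+ 2 by apply: adj_form_degenerate.
have Q1 z : frob 3 z = z -> frob 1 (Q z) = Q z.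
  by move=> z3; rewrite /Q rmorph_adj_form /= /A1 /A2 !f11 !f12 A3 z3 adj_form_rot.
have l3 z : frob 3 z = z -> frob 3 (l z) = l z.
  move=> z3; rewrite /l 2!rmorphD !rmorphM rmorphB !rmorphD.
  by rewrite !rmorphM rmorphXn rmorph1 /= /A1 /A2 !f31 // !f32 // A3 z3.
exists (cubic_subfield L :&: lker (linfun f))%VS; split; first last.
- by move=> z /memv_capP[_]; rewrite memv_ker fE => /eqP.
- exact: capvSl.
rewrite -ltnS; apply: leq_trans (dim_cubic q_odd dimL) _.
pose a := vpick (linfun f @: cubic_subfield L)%VS.
apply: (@dim_cap_lker_line _ _ _ _ _ a) => v vV.
have /memv_imgP[t tV aE] : a \in (linfun f @: cubic_subfield L)%VS by apply: memv_pick.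
(* [vpick] returns 0 exactly on the zero space, so here l vanishes identically. *)
have [a0|a_neq0] := eqVneq a 0.
  have /eqP im0 : (linfun f @: cubic_subfield L)%VS == 0%VS by rewrite -vpick0 -/a a0.
  have : linfun f v \in 0%VS by rewrite -im0 memv_img.
  by rewrite memv0 => /eqP->; apply: mem0v.
move: vV tV; rewrite !mem_cubic => /eqP v3 /eqP t3; rewrite fE in aE.
have : frob 1 (l v / l t) = l v / l t.
  apply: frob1_of_sqr => //; first by rewrite fmorph_div /= !l3.
  by rewrite expr_div_n -!lQ -mulf_div divff ?cayley_neq // mul1r fmorph_div /= !Q1.
move/eqP; rewrite -mem_base_field => /vlineP[c cE].
by apply/vlineP; exists c; rewrite fE aE -mulr_algl -cE divfK // -aE.
Qed.

(** On the plane W the normalized edge e is an F-valued binary form, so it is either zero at some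
    nonzero z or takes a prescribed nonzero value c^2; both give an edge with a root negated by
    [frob 3]. *)
Lemma exists_witness_degenerate : D = 0 -> exists r s, witness N d r s.
Proof.
move=> D0; have [W [dimW WV lW]] := dim_isotropic_plane D0.
pose e u v := (u * v + frob 1 u * frob 1 v + A * (u * frob 1 v + frob 1 u * v))
              / (1 - A ^+ 2).
have eE z : e z z = edge A z (frob 1 z) / (1 - A ^+ 2).
  by rewrite /e /edge; congr (_ / _); ring.
pose B u v : F := base_coord (e u v).
have B_lin u : linear (B u : L -> F^o).
  move=> a x y; rewrite -base_coord_linear; congr (base_coord _).
  rewrite /e frob_combination -[a *: x]mulr_algl -[a *: (_ / _)]mulr_algl.
  by move: a%:A => c; ring.
have B_sym u v : u \in W -> v \in W -> B u v = B v u.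
  by move=> _ _; rewrite /B /e; congr (base_coord (_ / _)); ring.
have alpha_neq0 : 1 - A ^+ 2 != 0.
  by have := cayley_neq 6%N; rewrite frob6.
have W3 z : z \in W -> frob 3 z = z by move/(subvP WV); rewrite mem_cubic => /eqP.
have e1 z : z \in W -> frob 1 (e z z) = e z z.
  move=> zW; rewrite eE fmorph_div rmorph_edge /= frob_one_sub_sqr f11.
  apply/(canLR (mulfK (cayley_neq 1%N)))/(mulfI alpha_neq0).
  rewrite -(edge_degenerate D0 (cayley_neq 1%N) (lW z zW)) -/A1.
  by field.
have alpha3 : frob 3 (1 - A ^+ 2) = 1 - A ^+ 2 by rewrite frob_one_sub_sqr A3.
have [y yE] := sqrt_frob3_fixed q_odd dimL alpha3.
(* The edge at 1/z will have root c y / (z z_1). The choice of w or 1 for c, according to the sign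
   in y_3 = y or -y, makes [frob 3] negate it. *)
have [c [c_neq0 c1 c_neg]] : exists c, [/\ c != 0, frob 1 (c ^+ 2) = c ^+ 2
    & frob 3 (c * y) = - (c * y)].
  have : frob 3 y ^+ 2 == y ^+ 2 by rewrite -rmorphXn /= -yE alpha3.
  rewrite eqf_sqr => /orP[]/eqP y3.
    exists w; split=> //; rewrite rmorphM /= (frob3_antifixed w1) y3; ring.
  by exists 1; split; rewrite ?oner_neq0 ?expr1n ?rmorph1 // mul1r.
have [|z [zW z_neq0 ez]] :=
  quadratic_zero_or_value q_odd B_lin B_sym (k := base_coord (c ^+ 2)) dimW.
  apply: contra_neq c_neq0 => c0; apply/eqP.
  by rewrite -sqrf_eq0 -(base_coordK c1) c0 scale0r.
have z3 := W3 z zW.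
have z1_neq0 : frob 1 z != 0 by rewrite fmorph_eq0.
have zz3 : frob 3 (z * frob 1 z) = z * frob 1 z by rewrite rmorphM /= f31 // z3.
have Q0 : adj_form A A1 A2 z (frob 1 z) (frob 2 z) z (frob 1 z) (frob 2 z) = 0.
  apply: (mulfI (cayley_neq 1%N)); rewrite adj_form_degenerate // lW //.
  by rewrite mulr0 expr0n.
have edgeE : edge A z^-1 (frob 1 z^-1) = e z z * (y / (z * frob 1 z)) ^+ 2.
  by rewrite fmorphV edgeV // expr_div_n -yE eE; field; rewrite z_neq0 z1_neq0.
case: ez => ez.
  exists (w * 0), z^-1; apply: witness_of_isotropic; rewrite ?rmorph0 ?oppr0 //.
  by rewrite edgeE -(base_coordK (e1 z zW)) -/(B z z) ez scale0r mul0r expr0n.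
exists (w * (c * y / (z * frob 1 z))), z^-1; apply: witness_of_isotropic => //.
  rewrite edgeE -(base_coordK (e1 z zW)) -/(B z z) ez (base_coordK c1); ring.
by rewrite fmorph_div /= c_neg zz3 mulNr.
Qed.

(** At the inverse of an isotropic vector the edge has a root y in L with y_3 = y or -y. The sign -
    or y = 0 gives a witness; otherwise [corner_sqr] exhibits -D as a square in the cubic
    subfield. *)
Lemma exists_witness_or_sqrt : D != 0 ->
  (exists r s, witness N d r s) \/ (exists2 m, frob 3 m = m & m ^+ 2 = - D).
Proof.
move=> D_neq0.
pose Q u v := adj_form A A1 A2 u (frob 1 u) (frob 2 u) v (frob 1 v) (frob 2 v).
pose B u v : F := base_coord (Q u v).
have B_lin u : linear (B u : L -> F^o).
  move=> a x y; rewrite -base_coord_linear; congr (base_coord _).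
  rewrite /Q !frob_combination -[a *: x]mulr_algl adj_form_linear mulr_algl.
  by [].
have B_sym u v : u \in cubic_subfield L -> v \in cubic_subfield L -> B u v = B v u.
  by move=> _ _; rewrite /B; congr (base_coord _); apply: adj_form_sym.
have [z [zV z_neq0]] := quadratic_isotropic q_odd B_lin B_sym (dim_cubic q_odd dimL).
move: zV; rewrite mem_cubic => /eqP z3.
have Q1 : frob 1 (Q z z) = Q z z.
  by rewrite /Q rmorph_adj_form /= /A1 /A2 !f11 !f12 A3 z3 adj_form_rot.
move=> Bz; have {Bz}Qz : Q z z = 0 by rewrite -(base_coordK Q1) -/(B z z) Bz scale0r.
set s := z^-1.
have s_neq0 : s != 0 by rewrite invr_eq0.
have s3 : frob 3 s = s by rewrite fmorphV /= z3.
have G3 : frob 3 (edge A s (frob 1 s)) = edge A s (frob 1 s).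
  by rewrite rmorph_edge /= f31 // s3 A3.
have [y yE] := sqrt_frob3_fixed q_odd dimL G3.
have : frob 3 y ^+ 2 == y ^+ 2 by rewrite -rmorphXn /= -yE G3.
rewrite eqf_sqr => /orP[]/eqP y3; last first.
  by left; exists (w * y), s; apply: witness_of_isotropic.
have [y0|y_neq0] := eqVneq y 0.
  by left; exists (w * y), s; apply: witness_of_isotropic; rewrite // y0 rmorph0 oppr0.
right; have := corner_sqr A A1 A2 s (frob 1 s) (frob 2 s).
rewrite edges_adj_form ?fmorph_eq0 // -!fmorphV /= invrK.
rewrite -[adj_form _ _ _ _ _ _ _ _ _]/(Q z z) Qz !mulr0 addr0 yE -/D.
set M := (corner _ _ _ _ _ _ * _ - _) => eM.
have s12 : frob 1 s * frob 2 s != 0 by rewrite mulf_neq0 ?fmorph_eq0.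
exists (M / (y * (frob 1 s * frob 2 s))).
  rewrite fmorph_div !rmorphM /= y3 f31 // f32 //; congr (_ / _).
  rewrite /M rmorphB 2!rmorphM rmorph_corner 2!rmorphD !rmorphM /=.
  by rewrite /A1 /A2 !f31 // !f32 // s3 A3 y3.
rewrite expr_div_n eM; field.
by move: s12; rewrite mulf_eq0 negb_or y_neq0 => /andP[-> ->].
Qed.

End NonTrivial.
End Criterion.

(** * The criterion assembled, with the case N = 1 treated apart *)

Theorem theorem3p4 (F : finFieldType) (L : fieldExtType F)
    (q_odd : odd #|F|) (dimL : \dim {:L} = 6%N) (b : L) (b_neq0 : b != 0) :
  maximum_scattered (Ub b) <->
  exists u : F, u != 0 /\ Delta b = (u ^+ 2)%:A.
Proof.
have [w w_neq0 w1] := exists_antifixed q_odd dimL.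
have two0 := two_neq0 L q_odd.
have four0 : 4 != 0 :> L by rewrite -[4]/((2 * 2)%:R) natrM mulf_neq0.
have scatE := scattered_witness q_odd dimL b_neq0 w_neq0 w1.
set N := b * frob 3 b in scatE.
have N_neq0 : N != 0 by rewrite mulf_neq0 ?fmorph_eq0.
have N3 : frob 3 N = N by rewrite rmorphM /= frob_comp frob6 // mulrC.
have f12 : frob 1 (frob 2 N) = N by rewrite frob_comp.
have f11 : frob 1 (frob 1 N) = frob 2 N by rewrite frob_comp.
have DeltaE := Delta_norm_poly b; rewrite /= -/N in DeltaE.
clearbody N.
have max_scat : maximum_scattered (Ub b) <-> scattered (Ub b).
  by split=> [[]//|scat]; split=> //; apply: dim_Ub.
(* For N = 1 the Cayley transform A is undefined; then s = 0 with any nonzero r of trace zero is a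
   witness, and [Delta] is 0. *)
rewrite max_scat scatE; have [N1|N_neq1] := eqVneq N 1.
  split=> [no_wit|[u [u_neq0]]].
    have [c c3 c1] := exists_cubic_not_base q_odd dimL.
    case: (no_wit (frob 1 c - c) 0); split; rewrite ?rmorph0 ?subr_eq0 ?c1 //.
    - by rewrite rmorphB /= frob_comp -(frob_comp 1 3) c3.
    - by rewrite !rmorphB /= !frob_comp -[(1 + 2)%N]/3%N c3; ring.
    - by rewrite N1; ring.
  rewrite DeltaE N1 !rmorph1 /norm_poly => Du.
  have : (u ^+ 2)%:A == 0 :> L by rewrite -Du; apply/eqP; ring.
  by rewrite scaler_eq0 oner_eq0 orbF sqrf_eq0 (negbTE u_neq0).
have fN k : frob k N != 1 by rewrite -(rmorph1 (frob k)) (inj_eq (fmorph_inj _)).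
pose A := (N + 1) / (N - 1).
have cayley k : frob k A = (frob k N + 1) / (frob k N - 1).
  by rewrite fmorph_div rmorphB rmorphD rmorph1.
have := gram_det_cayley N_neq1 (fN 1%N) (fN 2%N).
rewrite /= -DeltaE -!cayley -/A.
set D := gram_det _ _ _; set Pi := (_ * _ * _) => DE.
have Pi_neq0 : Pi != 0 by rewrite !mulf_neq0 // subr_eq0.
split=> [no_wit|[u [u_neq0 Du]] r s].
  have D_neq0 : D != 0.
    apply/eqP.
    move/(exists_witness_degenerate q_odd dimL N3 N_neq0 N_neq1 (erefl A) w_neq0 w1).
    by case=> r [s]; apply: no_wit.
  case: (exists_witness_or_sqrt q_odd dimL N3 N_neq1 (erefl A) w1 D_neq0).
    by case=> r [s /no_wit].
  (* v is a root of [Delta] in the cubic subfield. As [norm_poly] is invariant under cyclic shifts,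
     [Delta] lies in F, and hence so does v. *)
  case=> m m3 mD; pose v := m * Pi / 2.
  have v2 : v ^+ 2 = Delta b.
    apply: (mulfI four0); rewrite DE -[D]opprK -mD /v; field.
    by [].
  have f31 x : frob 3 x = x -> frob 3 (frob 1 x) = frob 1 x.
    by move=> x3; rewrite frob_comp -(frob_comp 1 3) x3.
  have Pi3 : frob 3 Pi = Pi.
    by rewrite /Pi !rmorphM !rmorphB rmorph1 /= N3 -f11 !f31.
  have v3 : frob 3 v = v by rewrite fmorph_div rmorphM rmorph_nat /= m3 Pi3.
  have v21 : frob 1 (v ^+ 2) = v ^+ 2.
    by rewrite v2 DeltaE rmorph_norm_poly /= f11 f12 norm_poly_rot.
  have vE := base_coordK (frob1_of_sqr q_odd v3 v21).
  exists (base_coord v); split.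
    apply: contra_neq D_neq0 => v0; move: v2; rewrite -vE v0 scale0r expr0n => D0.
    move/eqP: DE; rewrite -D0 mulr0 eq_sym mulf_eq0 oppr_eq0 sqrf_eq0.
    by rewrite (negbTE Pi_neq0) orbF => /eqP.
  by rewrite -v2 -{1}vE -!in_algE rmorphXn.
have u1 : frob 1 (u%:A : L) = u%:A by rewrite linearZ rmorph1.
apply: (not_witness_of_square q_odd N3 N_neq1 (erefl A) w_neq0 w1 u1).
  by rewrite scaler_eq0 oner_eq0 orbF.
by rewrite -DE Du -!in_algE rmorphXn /=; move: (u%:A) => v; ring.
Qed.
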